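(* Let $\mathbb{X},\mathbb{Y}$ be Euclidean spaces, $\Phi:\mathbb{X}\to\mathbb{Y}$ a linear operator, $R:\mathbb{X}\to\mathbb{R}$ a continuous convex function, $y_0\in\mathbb{Y}$, and let $x_0$ be an optimal solution of the problem $\min_{x\in\mathbb{X}} R(x)$ subject to $\Phi x=y_0$. Then $x_0$ is stably recoverable if and only if $$\operatorname{Ker}\Phi\cap T_{\partial R^*(\operatorname{Im}\Phi^* )}(x_0)=\{0\}.$$
   Context: Euclidean spaces are finite-dimensional real inner product spaces; $\|\cdot\|$ is the associated norm. $\Phi^*$ is the adjoint of $\Phi$, $\operatorname{Ker}$ and $\operatorname{Im}$ denote kernel and range. Fenchel conjugate: $R^*(v)=\sup\{\langle v,x\rangle-R(x)\mid x\in\mathbb{X}\}\in\mathbb{R}\cup\{\infty\}$. $\partial$ is the convex subdifferential, so $x\in\partial R^*(v)$ if and only if $v\in\partial R(x)$. For a set $S$, $\partial R^*(S):=\bigcup_{v\in S}\partial R^*(v)$. Tangent (contingent) cone: for a closed, possibly nonconvex, set $\Omega\subset\mathbb{X}$ and $x_0\in\Omega$, $T_\Omega(x_0):=\{w\in\mathbb{X}\mid \exists\, t_k\downarrow 0,\ w_k\to w:\ x_0+t_kw_k\in\Omega\}$. Stable recovery: for $y\in\mathbb{Y}$ and $\mu>0$ let $P(y,\mu)$ be the problem $\min_{x\in\mathbb{X}}\frac12\|\Phi x-y\|^2+\mu R(x)$. The optimal solution $x_0$ is called stably recoverable (stable recovery occurs at $x_0$) if for every constant $c>0$ there exist $K>0$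 and $\bar\delta>0$ such that for all $\delta\in(0,\bar\delta)$, all $y$ with $\|y-y_0\|\le\delta$, and $\mu=c\delta$, every optimal solution $x(y,\mu)$ of $P(y,\mu)$ satisfies $\|x(y,\mu)-x_0\|\le K\delta$. *)

(* Defs.v *)
From HB Require Import structures.
From mathcomp Require Import all_boot all_order all_algebra.
From mathcomp Require Import all_classical all_reals all_analysis.

Set Implicit Arguments.
Unset Strict Implicit.
Unset Printing Implicit Defensive.

Import Order.TTheory GRing.Theory Num.Theory.
Import numFieldNormedType.Exports.

Local Open Scope classical_set_scope.
Local Open Scope ring_scope.

(* The last axiom makes the ambient norm, and hence the topology, the one
   induced by the inner product; symmetry and left linearity give
   bilinearity. *)
HB.mixin Record NormedVector_isEuclidean (K : realType) E
    of NormedModule K E & Vector K E := {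
  dot : E -> E -> K ;
  dotC : forall x y, dot x y = dot y x ;
  dot_linearl : forall y a x z, dot (a *: x + z) y = a * dot x y + dot z y ;
  dot_norm : forall x, dot x x = `|x| ^+ 2
}.

#[short(type="euclideanType")]
HB.structure Definition Euclidean (K : realType) :=
  {E of NormedModule K E & Vector K E & NormedVector_isEuclidean K E}.

Section EuclideanTheory.
Context {K : realType}.

Lemma dot_linearr (E : euclideanType K) (x : E) a y z :
  dot x (a *: y + z) = a * dot x y + dot x z.
Proof. by rewrite dotC dot_linearl !(dotC _ x). Qed.

Lemma dot_eq0 (E : euclideanType K) (x : E) : dot x x = 0 -> x = 0.
Proof. by rewrite dot_norm => /eqP; rewrite expf_eq0/= normr_eq0 => /eqP. Qed.

Lemma dot_inj (E : euclideanType K) (u v : E) :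
  (forall x, dot x u = dot x v) -> u = v.
Proof.
move=> uv; apply/eqP; rewrite -subr_eq0; apply/eqP/dot_eq0.
have := dot_linearr (u - v) (-1) v u.
by rewrite scaleN1r addrC => ->; rewrite mulN1r uv addNr.
Qed.

Lemma riesz (E : euclideanType K) (l : {linear E -> K^o}) :
  exists v, forall x, l x = dot x v.
Proof.
have dl (v : E) : linear (fun x : E => dot x v : K^o).
  by move=> a x y; rewrite dot_linearl.
pose L v : {linear E -> K^o} := HB.pack (fun x : E => dot x v : K^o)
  (GRing.isLinear.Build _ _ _ _ _ (dl v)).
have Jl : linear (fun v : E => linfun (L v)).
  move=> a u v; apply/lfunP => x.
  rewrite add_lfunE scale_lfunE !lfunE/=. exact: dot_linearr.
pose J : {linear E -> 'Hom(E, K^o)} := HB.pack (fun v : E => linfun (L v))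
  (GRing.isLinear.Build _ _ _ _ _ Jl).
have kerJ : lker (linfun J) == 0%VS.
  apply/lker0P => u v; rewrite !lfunE/= => /lfunP uv.
  by apply: dot_inj => x; have := uv x; rewrite (lfunE (L u)) (lfunE (L v)).
have imJ : limg (linfun J) = fullv.
  apply/eqP; rewrite -dimv_leqif_eq ?subvf// limg_dim_eq; last first.
    by rewrite (eqP kerJ) capv0.
  by rewrite !dimvf /dim/= muln1.
have : linfun l \in limg (linfun J) by rewrite imJ memvf.
case/memv_imgP => v _ lv; exists v => x.
move/lfunP: lv => /(_ x); rewrite (lfunE J) /=.
by rewrite (lfunE l) (lfunE (L v)).
Qed.

Definition adjoint (X Y : euclideanType K) (Phi : 'Hom(X, Y)) (y : Y) : X :=
  xget 0 [set z | forall x, dot (Phi x) y = dot x z].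

Lemma adjointP (X Y : euclideanType K) (Phi : 'Hom(X, Y)) x y :
  dot (Phi x) y = dot x (adjoint Phi y).
Proof.
have dl : linear (fun x : X => dot (Phi x) y : K^o).
  by move=> a u v; rewrite linearP dot_linearl.
pose L : {linear X -> K^o} := HB.pack (fun x : X => dot (Phi x) y : K^o)
  (GRing.isLinear.Build _ _ _ _ _ dl).
have [v Lv] := riesz L.
by rewrite /adjoint; case: xgetP => [z _ ->//|/(_ v)]; case.
Qed.

End EuclideanTheory.

Section Definitions.
Context {K : realType} {X Y : euclideanType K}.

Definition argmin (D : set X) (f : X -> K) : set X :=
  [set x | D x /\ forall z, D z -> f x <= f z].

Definition fenchel_conjugate (R : X -> K) (v : X) : \bar K :=
  ereal_sup [set (dot v x - R x)%:E | x in [set: X]].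

Definition subdifferential (f : X -> \bar K) (v : X) : set X :=
  [set x | f v \is a fin_num /\
           forall u, (f v + (dot x (u - v))%:E <= f u)%E].

Definition tangent_cone (Omega : set X) (x0 : X) : set X :=
  [set w | exists (t : nat -> K) (u : nat -> X),
    [/\ forall k, 0 < t k,
        t k @[k --> \oo] --> (0 : K),
        u k @[k --> \oo] --> w
      & forall k, Omega (x0 + t k *: u k)]].

Definition regularized_objective (Phi : 'Hom(X, Y)) (R : X -> K) (y : Y)
    (mu : K) (x : X) : K :=
  2^-1 * `|Phi x - y| ^+ 2 + mu * R x.

Definition stably_recoverable (Phi : 'Hom(X, Y)) (R : X -> K) (y0 : Y)
    (x0 : X) : Prop :=
  forall c : K, 0 < c ->
  exists kappa dbar : K, [/\ 0 < kappa, 0 < dbar &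
    forall delta : K, 0 < delta < dbar ->
    forall y : Y, `|y - y0| <= delta ->
    forall x : X,
      argmin [set: X] (regularized_objective Phi R y (c * delta)) x ->
      `|x - x0| <= kappa * delta].

End Definitions.

(* Main.v *)
From HB Require Import structures.
Require Import Defs.
From mathcomp Require Import all_boot all_order all_algebra.
From mathcomp Require Import all_classical all_reals all_analysis.
From mathcomp Require Import ring lra.
Import Order.TTheory GRing.Theory Num.Theory.
Import numFieldNormedType.Exports.
Local Open Scope classical_set_scope.
Local Open Scope ring_scope.

(** The set whose tangent cone is taken consists of the [x] at which some
    [Phi^* p] is a subgradient of [R] ([certified_pointsE]); call [p] a
    certificate of [x]. By first-order optimality
    these are exactly the solutions of regularized problems: [x] minimizes
    [P(y, mu)] if and only if [Phi^* ((y - Phi x) / mu)] is a subgradient at [x]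
    ([regularized_argminP]). So the tangent cone records the directions in
    which regularized solutions can leave [x0], and stable recovery says that
    they never do so with [|Phi (x - x0)|] negligible against [|x - x0|].

    Suppose that recovery is stable and that [x0 + t_k u_k] is a sequence of
    certified points with [t_k -> 0] and [u_k -> w] in the kernel of [Phi].
    Subgradients are bounded near [x0], so the certificates [p_k] can be
    chosen bounded, by [L] say. With [c = 1 / (2 L)], the point [x0 + t_k u_k]
    solves [P(y_k, c delta_k)] for [y_k = Phi x_k + c delta_k p_k], a datum at
    distance at most [delta_k] from [y0] as soon as
    [delta_k >= 2 t_k |Phi u_k|]. Stability gives [|u_k| = O(delta_k / t_k)],
    and [delta_k / t_k] can be made to vanish because [Phi u_k -> Phi w = 0].
    Hence [w = 0] ([stable_recovery_tangent]).

    Conversely, a Lagrange multiplier at [x0] shows that a solution [x] of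
    [P(y, c delta)] always satisfies [|Phi (x - x0)| = O(delta)] and
    [R x <= R x0 + O(delta)] ([residual_bound]). If the cone meets the kernel
    only at [0], then [x0] is the only solution of the constrained problem
    ([unique_minimizer]), and a compactness argument
    ([near_minimizers_localized]) turns these bounds into convergence
    [x -> x0]. If [|x_k - x0|] were not [O(delta_k)], the normalized
    differences would accumulate at a unit vector that belongs both to the
    cone and to the kernel ([tangent_stable_recovery]).

    The multiplier ([lagrange_multiplier]) also gives the membership of [0] in
    the cone and, for [Phi] the identity, the subgradients that make the
    conjugate function determine the subgradients of [R]
    ([subdifferential_conjugate]). It is obtained as a limit of the negated
    gradients of penalty terms. *)

(** * Inner products and compactness in Euclidean spaces *)

Section EuclideanGeometry.
Context {K : realType}.
Implicit Types X Y : euclideanType K.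

Lemma dotDl X (x y z : X) : dot (x + y) z = dot x z + dot y z.
Proof. by have := dot_linearl z 1 x y; rewrite scale1r mul1r. Qed.

Lemma dot0l X (z : X) : dot 0 z = 0.
Proof. by apply: (addrI (dot 0 z)); rewrite -dotDl !addr0. Qed.

Lemma dotZl X a (x z : X) : dot (a *: x) z = a * dot x z.
Proof. by have := dot_linearl z a x 0; rewrite !addr0 dot0l addr0. Qed.

Lemma dotNl X (x z : X) : dot (- x) z = - dot x z.
Proof. by rewrite -scaleN1r dotZl mulN1r. Qed.

Lemma dotBl X (x y z : X) : dot (x - y) z = dot x z - dot y z.
Proof. by rewrite dotDl dotNl. Qed.

Lemma dotDr X (x y z : X) : dot z (x + y) = dot z x + dot z y.
Proof. by rewrite !(dotC z) dotDl. Qed.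

Lemma dotZr X a (x z : X) : dot z (a *: x) = a * dot z x.
Proof. by rewrite !(dotC z) dotZl. Qed.

Lemma dotNr X (x z : X) : dot z (- x) = - dot z x.
Proof. by rewrite !(dotC z) dotNl. Qed.

Lemma dotBr X (x y z : X) : dot z (x - y) = dot z x - dot z y.
Proof. by rewrite dotDr dotNr. Qed.

Lemma sqr_normD X (x y : X) :
  `|x + y| ^+ 2 = `|x| ^+ 2 + 2 * dot x y + `|y| ^+ 2.
Proof. by rewrite -!dot_norm dotDl !dotDr (dotC y x); ring. Qed.

(** Expands the square of the norm of [|y|^2 x - <x, y> y], a multiple of the
    component of [x] orthogonal to [y]. *)
Lemma cauchy_schwarz X (x y : X) : `|dot x y| <= `|x| * `|y|.
Proof.
have [->|y0] := eqVneq y 0; first by rewrite dotC dot0l !normr0 mulr0.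
have ny : 0 < `|y| by rewrite normr_gt0.
have := sqr_ge0 `| `|y| ^+ 2 *: x - dot x y *: y|.
rewrite -dot_norm dotBl !dotBr !dotZl !dotZr (dotC y x) !dot_norm.
set a := `|x|; set b := `|y|; set d := dot x y => h.
have {h} : 0 <= b ^+ 2 * (a ^+ 2 * b ^+ 2 - d ^+ 2).
  by apply: le_trans h _; rewrite le_eqVlt; apply/orP; left; apply/eqP; ring.
rewrite pmulr_rge0 ?exprn_gt0// subr_ge0 -exprMn.
by rewrite -(real_normK (num_real d)) ler_sqr // nnegrE mulr_ge0 ?/a ?/b.
Qed.

(** By polarization the inner product is a continuous function of norms. *)
Lemma cvg_dot X T (F : set_system T) (FF : Filter F) (u v : T -> X) (a b : X) :
  u x @[x --> F] --> a -> v x @[x --> F] --> b ->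
  dot (u x) (v x) @[x --> F] --> dot a b.
Proof.
have polar (x y : X) :
    dot x y = 2^-1 * (`|x + y| * `|x + y| - `|x| * `|x| - `|y| * `|y|).
  by rewrite -!expr2 sqr_normD; field.
move=> ua vb; rewrite (polar a b).
under eq_cvg do rewrite polar.
apply: cvgM; first exact: cvg_cst.
apply: cvgB; last by apply: cvgM; exact: cvg_norm.
apply: cvgB; last by apply: cvgM; exact: cvg_norm.
by apply: cvgM; apply: cvg_norm; exact: cvgD.
Qed.

Lemma cvg_sqr_norm X T (F : set_system T) (FF : Filter F) (u : T -> X) (a : X) :
  u x @[x --> F] --> a -> `|u x| ^+ 2 @[x --> F] --> `|a| ^+ 2.
Proof.
move=> ua; rewrite -dot_norm; under eq_cvg do rewrite -dot_norm.
exact: cvg_dot.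
Qed.

Lemma adjoint_is_linear X Y (Phi : 'Hom(X, Y)) : linear (adjoint Phi).
Proof.
move=> a u v; apply: dot_inj => x.
by rewrite -adjointP dot_linearr !adjointP -dot_linearr.
Qed.

HB.instance Definition _ X Y (Phi : 'Hom(X, Y)) :=
  GRing.isLinear.Build K Y X _ (adjoint Phi) (adjoint_is_linear X Y Phi).

(** A linear map is a finite sum of coordinate functionals times vectors, and
    each of these functionals is a pairing with a fixed vector, hence bounded
    by Cauchy-Schwarz. *)
Lemma linear_bounded X Y (f : {linear X -> Y}) :
  exists2 C, 0 < C & forall x, `|f x| <= C * `|x|.
Proof.
pose e := vbasis {:X}.
have /choice[r rE] (i : 'I_(\dim {:X})) :
    exists v : X, forall x, coord e i x = dot x v.
  exact: riesz (coord e i).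
pose C := \sum_i `|r i| * `|f e`_i|.
have C0 : 0 <= C by apply: sumr_ge0 => i _; exact: mulr_ge0.
exists (C + 1) => [|x]; first by rewrite ltr_wpDl.
apply: (@le_trans _ _ (C * `|x|)); last by rewrite ler_wpM2r// lerDl.
rewrite {1}(coord_vbasis (memvf x)) linear_sum /C mulr_suml.
apply: le_trans (ler_norm_sum _ _ _) _.
apply: ler_sum => i _; rewrite linearZ/= normrZ mulrAC ler_wpM2r//.
by rewrite rE mulrC; exact: cauchy_schwarz.
Qed.

Lemma linear_continuous X Y (f : {linear X -> Y}) : continuous f.
Proof.
have [C C0 fC] := linear_bounded X Y f.
move=> x; apply/cvgrPdist_le => e e0; near=> z.
rewrite -linearB; apply: le_trans (fC _) _.
rewrite mulrC -ler_pdivlMr//; near: z.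
by apply: cvgr_dist_le; [exact: cvg_id|exact: divr_gt0].
Unshelve. all: by end_near. Qed.

(** The closed ball lies in the continuous image of a compact box of
    coordinates. *)
Lemma compact_closed_ball X (a : X) r : compact [set x : X | `|x - a| <= r].
Proof.
pose e := vbasis {:X}; pose n := \dim {:X}.
have /choice[v vE] (i : 'I_n) :
    exists v : X, forall x, coord e i x = dot x v.
  exact: riesz (coord e i).
pose g (c : 'rV[K]_n) : X := \sum_(i < n) c ord0 i *: e`_i.
have cg : continuous g.
  apply: continuous_big => [|i _ c]; first exact: add_continuous.
  by apply: (@cvgZr_tmp _ _ _ (nbhs c) (nbhs_filter c)); exact: coord_continuous.
pose B := [set c : 'rV[K]_n | forall i,
  c ord0 i \in `[- ((`|a| + r) * `|v i|), (`|a| + r) * `|v i|]].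
have cB : compact B.
  apply: (@rV_compact _ _
    (fun i => `[- ((`|a| + r) * `|v i|), (`|a| + r) * `|v i|]%classic)).
  by move=> i; exact: segment_compact.
apply: (@subclosed_compact _ _ (g @` B)); last 1 first.
- move=> x /= xr; exists (\row_i coord e i x).
    move=> i; rewrite mxE in_itv/= -ler_norml vE.
    apply: le_trans (cauchy_schwarz _ _ _) _; rewrite ler_wpM2r//.
    by have := ler_normD (x - a) a; rewrite subrK; lra.
  rewrite /g [RHS](coord_vbasis (memvf x)).
  by apply: eq_bigr => i _; rewrite mxE.
- apply: (@closed_comp _ _ (fun x : X => `|x - a|) [set t | t <= r]).
    move=> x _; apply: cvg_norm; apply: cvgB; [exact: cvg_id|exact: cvg_cst].
  exact: closed_le.
- by apply: continuous_compact => //; exact: continuous_subspaceT.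
Qed.

Lemma compact_sphere X (a : X) r : compact [set x : X | `|x - a| = r].
Proof.
apply: (subclosed_compact _ (compact_closed_ball X a r)) => [|x /= ->//].
apply: (@closed_comp _ _ (fun x : X => `|x - a|) [set r]).
  move=> x _; apply: cvg_norm; apply: cvgB; [exact: cvg_id|exact: cvg_cst].
exact: closed_eq.
Qed.

(** The indices only tend to infinity and need not increase; that suffices to
    transport limits along [phi]. *)
Lemma compact_subsequence X (S : set X) (u : nat -> X) :
  compact S -> (forall n, S (u n)) ->
  exists (phi : nat -> nat) (l : X),
    [/\ S l, phi n @[n --> \oo] --> \oo & u (phi n) @[n --> \oo] --> l].
Proof.
move=> cS uS.
have uFS : (u @ \oo) S by exists 0%N => // n _; exact: uS.
have [l [Sl lcl]] := cS (u @ \oo) _ uFS.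
have /choice[phi phiE] n : exists m, (n <= m)%N /\ `|l - u m| < n.+1%:R^-1.
  have nl : nbhs l (ball l n.+1%:R^-1).
    by apply: nbhsx_ballx; rewrite invr_gt0.
  have nu : (u @ \oo) (u @` [set m | (n <= m)%N]).
    by exists n => // m nm; exists m.
  have [_ [[m nm <-] lm]] := lcl _ _ nu nl.
  by exists m; split=> //; move: lm; rewrite -ball_normE.
exists phi, l; split=> //.
  apply/cvgnyPge => A; near=> n; have [+ _] := phiE n; apply: leq_trans.
  by near: n; exact: nbhs_infty_ge.
apply/cvgrPdist_le => e e0; near=> n.
have [_ /ltW/le_trans->//] := phiE n.
by apply: ltW; near: n; exact: near_infty_natSinv_lt (PosNum e0).
Unshelve. all: by end_near. Qed.

End EuclideanGeometry.

(** * Convex functions: optimality and penalization *)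

Section ConvexAnalysis.
Context {K : realType}.
Implicit Types X Y : euclideanType K.

(** The subdifferential of a finite function, in real-valued form;
    [subdifferential] is kept for the conjugate, which can be infinite. *)
Definition subgradients X (R : X -> K) (x : X) : set X :=
  [set v | forall z, R x + dot v (z - x) <= R z].

Lemma convex_function_ray X (R : X -> K) (x h : X) (t : K) :
  convex_function [set: convex_lmodType X] R -> 0 <= t <= 1 ->
  R (x + t *: h) <= R x + t * (R (x + h) - R x).
Proof.
move=> cR /andP[t0 t1].
have := cR (Itv01 t0 t1) (x + h) x (in_setT _) (in_setT _).
rewrite /conv/= /conv/= /unstable.onem.
have -> : t *: (x + h) + (1 - t) *: x = x + t *: h.
  by rewrite scalerDr addrAC -scalerDl addrC subrKC scale1r addrC.
move/le_trans; apply; rewrite le_eqVlt; apply/orP; left; apply/eqP.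
by rewrite /GRing.scale/=; ring.
Qed.

(** Along the segment from [x] to [z] the error term in the expansion of [q] is
    of second order, so a local minimum of
    [R + q] forces the first-order term
    [R z - R x + <g, z - x>] to be nonnegative. *)
Lemma fermat_smooth X (R q : X -> K) (x g : X) (C r : K) :
  convex_function [set: convex_lmodType X] R -> 0 < r ->
  (forall h, q (x + h) <= q x + dot g h + C * `|h| ^+ 2) ->
  (forall h, `|h| <= r -> R x + q x <= R (x + h) + q (x + h)) ->
  subgradients X R x (- g).
Proof.
move=> cR r0 qh xmin z.
set h := z - x; have xh : x + h = z by rewrite /h addrC subrK.
rewrite dotNl -subr_ge0 leNgt; apply/negP => a0.
set a := R z - (R x - dot g h) in a0.
pose b := `|C| * `|h| ^+ 2.
have b0 : 0 <= b by rewrite mulr_ge0 ?sqr_ge0.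
(* the three bounds keep the step inside the segment, inside the ball of
   local minimality, and below the scale at which the quadratic error could
   compensate the negative slope a *)
pose t := Num.min 1 (Num.min (r / (`|h| + 1)) (- a / (b + 1))).
have h1 : 0 < `|h| + 1 by rewrite ltr_wpDl.
have b1 : 0 < b + 1 by rewrite ltr_wpDl.
have t0 : 0 < t by rewrite !lt_min ltr01 !divr_gt0 ?oppr_gt0.
have t1 : t <= 1 by rewrite ge_min lexx.
have tr : t * (`|h| + 1) <= r by rewrite -ler_pdivlMr// !ge_min lexx !orbT.
have tb : t * (b + 1) <= - a by rewrite -ler_pdivlMr// !ge_min lexx !orbT.
have := xmin (t *: h); rewrite normrZ gtr0_norm// => /(_ _)/wrap[].
  by nra.
have := convex_function_ray X R x h t cR; rewrite (ltW t0) t1 xh => /(_ isT).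
have := qh (t *: h); rewrite dotZr normrZ gtr0_norm// exprMn.
have Cb : C * `|h| ^+ 2 <= b by rewrite ler_wpM2r ?sqr_ge0 ?ler_norm.
move=> h2 h3 h4.
have : 0 <= t * (a + t * b).
  have : 0 <= t * a + t ^+ 2 * (C * `|h| ^+ 2) by rewrite /a; lra.
  have := ler_wpM2l (sqr_ge0 t) Cb; rewrite expr2; lra.
by rewrite pmulr_rge0//; lra.
Qed.

(** Where [f] exceeds [a] on the fibre of [Phi] through [x0], a large enough
    quadratic penalty makes the penalized function exceed [a] on the whole
    compact set, with a margin. Otherwise violating points for larger and
    larger penalties would accumulate on the fibre, at a point where
    [f <= a]. *)
Lemma penalization X Y (Phi : 'Hom(X, Y)) (f : X -> K) (S : set X) (x0 : X)
    (a : K) :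
  continuous f -> compact S -> (forall x, S x -> Phi x = Phi x0 -> a < f x) ->
  exists (n : nat) (eta : K), 0 < eta /\
    forall x, S x -> a + eta <= f x + n%:R * `|Phi (x - x0)| ^+ 2.
Proof.
move=> cf cS fa; apply: contrapT => no.
have /choice[u uE] (n : nat) : exists x, S x /\
    f x + n.+1%:R * `|Phi (x - x0)| ^+ 2 < a + n.+1%:R^-1.
  apply: contrapT => nx; apply: no; exists n.+1, n.+1%:R^-1; split=> // x Sx.
  by rewrite leNgt; apply/negP => xa; apply: nx; exists x.
have uS n : S (u n) by have [] := uE n.
have [phi [l [Sl phioo ul]]] := compact_subsequence X S u cS uS.
have h0 : (phi n).+1%:R^-1 @[n --> \oo] --> (0 : K).
  exact: cvg_comp phioo (@cvg_harmonic K).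
have [|c _ fc] := compact_EVT_min (ex_intro _ _ Sl) cS (f := f).
  exact: continuous_subspaceT.
have fge n : f c <= f (u n) by apply: fc; exact: mem_set.
have Phil : Phi (l - x0) = 0.
  apply/eqP; rewrite -normr_eq0 -sqrf_eq0 eq_le sqr_ge0 andbT.
  apply: (@ler_cvg_to _ (\oo : set_system nat) _ K
    (fun n => `|Phi (u (phi n) - x0)| ^+ 2)
    (fun n => (a + 1 - f c) * (phi n).+1%:R^-1)).
  - apply: cvg_sqr_norm; apply: (continuous_cvg _ (linear_continuous X Y Phi _)).
    by apply: cvgB => //; exact: cvg_cst.
  - by rewrite -[X in _ --> X](mulr0 (a + 1 - f c)); apply: cvgMr.
  - apply: nearW => n.
    have [_] := uE (phi n); have := fge (phi n).
    rewrite ler_pdivlMr//.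
    have : (phi n).+1%:R^-1 <= 1 :> K by rewrite invf_le1// ler1n.
    by move: (phi n).+1%:R => N; lra.
have : f l <= a.
  apply: (@ler_cvg_to _ (\oo : set_system nat) _ K
    (fun n => f (u (phi n))) (fun n => a + (phi n).+1%:R^-1)).
  - exact: (continuous_cvg _ (cf l)).
  - by rewrite -[X in _ --> X]addr0; apply: cvgD => //; exact: cvg_cst.
  - apply: nearW => n; have [_] := uE (phi n).
    have : 0 <= (phi n).+1%:R * `|Phi (u (phi n) - x0)| ^+ 2.
      by rewrite mulr_ge0 ?sqr_ge0.
    by move: (phi n).+1%:R => N; lra.
apply/negP; rewrite -ltNge; apply: fa => //.
by apply/eqP; rewrite -subr_eq0 -Phil linearB.
Qed.

End ConvexAnalysis.

(** * Multipliers, conjugates and regularized problems *)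

Section Multipliers.
Context {K : realType}.
Implicit Types X Y : euclideanType K.

(** A subgradient [v] at [x] makes [R] grow by at least [|v|] along the unit
    step in the direction of [v], while the oscillation of [R] on a ball is
    finite. *)
Lemma subgradients_locally_bounded X (R : X -> K) (x0 : X) : continuous R ->
  exists M, forall x v, `|x - x0| <= 1 -> subgradients X R x v -> `|v| <= M.
Proof.
move=> cR; pose B := [set x : X | `|x - x0| <= 2].
have cB : compact B := compact_closed_ball X x0 2.
have B0 : B !=set0 by exists x0; rewrite /B/= subrr normr0.
have cRB : {within B, continuous R} by exact: continuous_subspaceT.
have [a _ Ra] := compact_EVT_max B0 cB cRB.
have [b _ Rb] := compact_EVT_min B0 cB cRB.
exists (R a - R b) => x v xx0 vR.
have Bx : x \in B by apply/mem_set; rewrite /B/=; lra.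
have [->|v0] := eqVneq v 0.
  by rewrite normr0; have := Ra _ Bx; have := Rb _ Bx; lra.
have nv : 0 < `|v| by rewrite normr_gt0.
pose z := x + `|v|^-1 *: v.
have Bz : z \in B.
  apply/mem_set; rewrite /B/= /z addrAC.
  have : `| `|v|^-1 *: v| = 1.
    by rewrite normrZ gtr0_norm ?invr_gt0// mulVf// gt_eqF.
  by have := ler_normD (x - x0) (`|v|^-1 *: v); lra.
have := vR z; rewrite /z [x + _]addrC addrK dotZr dot_norm expr2 mulKf ?gt_eqF//.
by have := Ra _ Bz; have := Rb _ Bx; rewrite /z [x + _]addrC; lra.
Qed.

Lemma subgradients_closed X (R : X -> K) (u v : nat -> X) (x w : X) :
  {for x, continuous R} ->
  u n @[n --> \oo] --> x -> v n @[n --> \oo] --> w ->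
  (forall n, subgradients X R (u n) (v n)) -> subgradients X R x w.
Proof.
move=> cR ux vw uv z.
apply: (@cvgr_to_le _ (\oo : set_system nat) _ K
  (fun n => R (u n) + dot (v n) (z - u n))).
  apply: cvgD; first exact: continuous_cvg.
  by apply: cvg_dot => //; apply: cvgB => //; exact: cvg_cst.
by apply: nearW => n; exact: uv.
Qed.

(** A linear choice of preimages under [Phi^*]: being linear it is bounded and
    continuous, which makes the range of [Phi^*] closed and lets bounded
    subgradients have bounded certificates. *)
Lemma adjoint_section X Y (Phi : 'Hom(X, Y)) :
  exists G : 'Hom(X, Y), forall p, adjoint Phi (G (adjoint Phi p)) = adjoint Phi p.
Proof.
exists ((linfun (adjoint Phi))^-1)%VF => p.
have := @limg_lfunVK _ _ _ (linfun (adjoint Phi)) (adjoint Phi p).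
rewrite lfunE; apply.
by rewrite -[X in X \in _](lfunE (adjoint Phi)) memv_img ?memvf.
Qed.

(** Subgradients near [x0] are bounded, so those at the approximating points
    accumulate; the limit is a subgradient at [x0], and it stays in the range
    of [Phi^*] because the section of [Phi^*] is continuous. *)
Lemma multiplier_of_approximations X Y (Phi : 'Hom(X, Y)) (R : X -> K) (x0 : X) :
  continuous R ->
  (forall n, exists u v, [/\ `|u - x0| < n.+1%:R^-1, subgradients X R u v &
     range (adjoint Phi) (v + (u - x0))]) ->
  exists p, subgradients X R x0 (adjoint Phi p).
Proof.
move=> cR /choice[u] /choice[v] uv.
have [M RM] := subgradients_locally_bounded X R x0 cR.
have ux n : `|u n - x0| < n.+1%:R^-1 by have [] := uv n.
have vR n : subgradients X R (u n) (v n) by have [] := uv n.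
have vM n : [set w | `|w - 0| <= M] (v n).
  rewrite /= subr0; apply: RM (vR n).
  by apply: le_trans (ltW (ux n)) _; rewrite invf_le1// ler1n.
have [phi [w [_ phioo vw]]] :=
  compact_subsequence X _ v (compact_closed_ball X 0 M) vM.
have ucvg : u n @[n --> \oo] --> x0.
  apply/cvgrPdist_le => e e0; near=> n; rewrite distrC.
  apply: le_trans (ltW (ux n)) _.
  by apply: ltW; near: n; exact: near_infty_natSinv_lt (PosNum e0).
have uphi : u (phi n) @[n --> \oo] --> x0 by exact: cvg_comp phioo ucvg.
have wR : subgradients X R x0 w.
  exact: (subgradients_closed X R _ _ _ _ (cR x0) uphi vw).
have [G GE] := adjoint_section X Y Phi.
exists (G w); suff -> : adjoint Phi (G w) = w by [].
have sw : (v (phi n) + (u (phi n) - x0)) @[n --> \oo] --> w.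
  rewrite -[X in _ --> X]addr0; apply: cvgD => //.
  by rewrite -[X in _ --> X](subrr x0); apply: cvgB => //; exact: cvg_cst.
have cA : continuous (adjoint Phi) := linear_continuous Y X (adjoint Phi).
have cG : continuous G := linear_continuous X Y G.
have := continuous_cvg eventually_filter (cA _)
  (continuous_cvg eventually_filter (cG _) sw).
have -> : adjoint Phi \o (G \o (fun n => v (phi n) + (u (phi n) - x0)))
    = (fun n => v (phi n) + (u (phi n) - x0)).
  by apply/funext => n /=; have [_ _ [p _ <-]] := uv (phi n); rewrite GE.
by move=> sw'; exact: (cvg_unique (@norm_hausdorff K X) sw' sw).
Unshelve. all: by end_near. Qed.

(** On the sphere of radius [r] about [x0] the function
    [R + |x - x0|^2 / 2 + N |Phi (x - x0)|^2] exceeds its value at [x0], for [N]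
    large. Its minimizer on the ball is therefore interior, and the
    first-order condition there gives a subgradient that differs by
    [x - x0], hence by less than [r], from an element of the range of
    [Phi^*]. *)
Lemma lagrange_multiplier X Y (Phi : 'Hom(X, Y)) (R : X -> K) (x0 : X) :
  continuous R -> convex_function [set: convex_lmodType X] R ->
  (forall z, Phi z = Phi x0 -> R x0 <= R z) ->
  exists p, subgradients X R x0 (adjoint Phi p).
Proof.
move=> cR cvxR x0min; apply: multiplier_of_approximations => // m.
set r : K := m.+1%:R^-1; have r0 : 0 < r by rewrite invr_gt0.
have cnorm : continuous (fun x : X => `|x - x0| ^+ 2).
  move=> x; apply: cvg_sqr_norm.
  by apply: cvgB; [exact: cvg_id|exact: cvg_cst].
pose f x := R x + 2^-1 * `|x - x0| ^+ 2.
have cf : continuous f.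
  move=> x; apply: cvgD; first exact: cR.
  by apply: cvgM; [exact: cvg_cst|exact: cnorm].
(* the square makes x0 the strict minimizer of f on its fibre *)
have fa x : `|x - x0| = r -> Phi x = Phi x0 -> R x0 < f x.
  move=> xr /x0min Rx; rewrite /f xr.
  have : 0 < r ^+ 2 by rewrite exprn_gt0.
  lra.
have [N [eta [eta0 feta]]] :=
  penalization X Y Phi f _ x0 (R x0) cf (compact_sphere X x0 r) fa.
pose q x := 2^-1 * `|x - x0| ^+ 2 + N%:R * `|Phi (x - x0)| ^+ 2.
have cF : continuous (fun x => R x + q x).
  move=> x; apply: cvgD; first exact: cR.
  apply: cvgD; first by apply: cvgM; [exact: cvg_cst|exact: cnorm].
  apply: cvgM; first exact: cvg_cst.
  apply: cvg_sqr_norm; apply: (continuous_cvg _ (linear_continuous X Y Phi _)).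
  by apply: cvgB; [exact: cvg_id|exact: cvg_cst].
pose B := [set x : X | `|x - x0| <= r].
have Bx0 : B x0 by rewrite /B/= subrr normr0 ltW.
have [|u Bu Fu] := compact_EVT_min (ex_intro _ _ Bx0)
  (compact_closed_ball X x0 r) (f := fun x => R x + q x).
  exact: continuous_subspaceT.
have ur : `|u - x0| < r.
  rewrite lt_neqAle (set_mem Bu : B u) andbT; apply/eqP => urE.
  have := feta u urE; have := Fu _ (mem_set Bx0).
  by rewrite /q /f subrr linear0 !normr0 expr0n/= !mulr0 !addr0; lra.
have [C C0 PhiC] := linear_bounded X Y Phi.
pose g := (u - x0) + adjoint Phi ((2 * N%:R) *: Phi (u - x0)).
exists u, (- g); split=> //; last first.
  exists (- ((2 * N%:R) *: Phi (u - x0))) => //.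
  by rewrite linearN /g opprD addrAC addNr add0r.
apply: (fermat_smooth X R q u g (2^-1 + N%:R * C ^+ 2) (r - `|u - x0|)) => //.
- by rewrite subr_gt0.
- move=> h; rewrite /q addrAC linearD/= !sqr_normD /g dotDl.
  rewrite [dot (adjoint _ _) _]dotC -adjointP dotZr (dotC (Phi h)).
  have : `|Phi h| ^+ 2 <= C ^+ 2 * `|h| ^+ 2.
    by rewrite -exprMn ler_sqr ?nnegrE ?PhiC// mulr_ge0// ltW.
  by move/(ler_wpM2l (ler0n K N)); lra.
- move=> h hr; apply: Fu; apply: mem_set; rewrite /B/= addrAC.
  by have := ler_normD (u - x0) h; lra.
Qed.

Lemma subgradient_exists X (R : X -> K) (x : X) :
  continuous R -> convex_function [set: convex_lmodType X] R ->
  exists v, subgradients X R x v.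
Proof.
move=> cR cvxR.
have [|p px] := lagrange_multiplier X X \1%VF R x cR cvxR.
  by move=> z; rewrite !id_lfunE => ->.
by exists (adjoint \1%VF p).
Qed.

Lemma fenchel_conjugate_subgradient X (R : X -> K) (x v : X) :
  subgradients X R x v -> fenchel_conjugate R v = (dot v x - R x)%:E.
Proof.
move=> vR; apply/eqP; rewrite eq_le; apply/andP; split.
  apply: ge_ereal_sup => _ [z _ <-]; rewrite lee_fin.
  by have := vR z; rewrite dotBr; lra.
by apply: ereal_sup_ubound; exists x.
Qed.

(** From right to left this is the equality case of the Fenchel-Young
    inequality. From left to right, the affine minorant of the conjugate is
    tested at a subgradient [u] of [R] at [x], where the conjugate is
    [<u, x> - R x]: this bounds the conjugate at [v] by [<v, x> - R x]. *)
Lemma subdifferential_conjugate X (R : X -> K) (x v : X) :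
  continuous R -> convex_function [set: convex_lmodType X] R ->
  subdifferential (fenchel_conjugate R) v x <-> subgradients X R x v.
Proof.
move=> cR cvxR; have fge z w : ((dot w z - R z)%:E <= fenchel_conjugate R w)%E.
  by apply: ereal_sup_ubound; exists z.
split=> [[fv vx] z|vR].
  have [u uR] := subgradient_exists X R x cR cvxR.
  have := vx u; rewrite (fenchel_conjugate_subgradient X R x u uR).
  have := fge z v; rewrite -(fineK fv) -EFinD !lee_fin !dotBr.
  by rewrite (dotC x u) (dotC x v); lra.
split=> [|u]; rewrite (fenchel_conjugate_subgradient X R x v vR)//.
apply: le_trans (fge x u); rewrite -EFinD lee_fin dotBr.
by rewrite (dotC x u) (dotC x v); lra.
Qed.

(** Necessity is [fermat_smooth] for the residual divided by [mu]; sufficiency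
    holds because the residual is its linearization at [x] plus the square
    [|Phi (z - x)|^2 / 2]. *)
Lemma regularized_argminP X Y (Phi : 'Hom(X, Y)) (R : X -> K) (y : Y) (mu : K)
    (x : X) :
  convex_function [set: convex_lmodType X] R -> 0 < mu ->
  argmin [set: X] (regularized_objective Phi R y mu) x <->
  subgradients X R x (adjoint Phi (mu^-1 *: (y - Phi x))).
Proof.
move=> cvxR mu0.
have expand h : `|Phi (x + h) - y| ^+ 2 =
    `|Phi x - y| ^+ 2 + 2 * dot (Phi x - y) (Phi h) + `|Phi h| ^+ 2.
  by rewrite linearD/= addrAC sqr_normD.
split=> [[_ xmin]|xR].
  have [C C0 PhiC] := linear_bounded X Y Phi.
  have -> : y - Phi x = - (Phi x - y) by rewrite opprB.
  rewrite scalerN linearN.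
  apply: (fermat_smooth X R (fun z => mu^-1 * (2^-1 * `|Phi z - y| ^+ 2)) x _
    (mu^-1 * (2^-1 * C ^+ 2)) 1) => // h.
    rewrite expand (dotC (adjoint _ _)) -adjointP dotZr (dotC (Phi h)).
    have : `|Phi h| ^+ 2 <= C ^+ 2 * `|h| ^+ 2.
      by rewrite -exprMn ler_sqr ?nnegrE ?PhiC// mulr_ge0// ltW.
    have mu20 : 0 <= mu^-1 * 2^-1 by rewrite mulr_ge0 ?invr_ge0 ?ltW.
    by move/(ler_wpM2l mu20); lra.
  move=> _; have := xmin (x + h) I; rewrite /regularized_objective => le.
  rewrite -(ler_pM2l mu0) !mulrDr !mulrA mulfV ?gt_eqF// !mul1r.
  lra.
split=> // z _; have := xR z.
rewrite (dotC (adjoint _ _)) -adjointP dotZr.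
rewrite /regularized_objective.
have := expand (z - x); rewrite subrKC => ->; set h := Phi (z - x).
have -> : dot (Phi x - y) h = - dot h (y - Phi x).
  by rewrite dotC -dotNr opprB.
move/(ler_wpM2l (ltW mu0)); rewrite mulrDr mulrA mulfV ?gt_eqF// mul1r.
by have := sqr_ge0 `|h|; lra.
Qed.

End Multipliers.

(** * Stable recovery *)

Section StableRecovery.
Context {K : realType} {X Y : euclideanType K}.
Context (Phi : 'Hom(X, Y)) (R : X -> K) (x0 : X).
Context (cR : continuous R)
  (cvxR : convex_function [set: convex_lmodType X] R).

Let Omega :=
  \bigcup_(v in range (adjoint Phi)) subdifferential (fenchel_conjugate R) v.

Lemma certified_pointsE x :
  Omega x <-> exists p, subgradients X R x (adjoint Phi p).
Proof.
split=> [[_ [p _ <-]] /(subdifferential_conjugate X R x _ cR cvxR) px|[p px]].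
  by exists p.
exists (adjoint Phi p); first by exists p.
exact/(subdifferential_conjugate X R x _ cR cvxR).
Qed.

(** Each point of a tangent sequence is itself the solution of a regularized
    problem whose datum is within [delta] of [Phi x0]; stability applied to
    it bounds [|u k|] by a multiple of [|Phi (u k)|] plus a null sequence. *)
Lemma stable_recovery_tangent w :
  stably_recoverable Phi R (Phi x0) x0 -> w \in lker Phi ->
  tangent_cone Omega x0 w -> w = 0.
Proof.
move=> stab /[!memv_ker] /eqP Phiw [t [u [t0 tcvg ucvg Omu]]].
have /choice[p pR] k := (certified_pointsE _).1 (Omu k).
have [G GE] := adjoint_section X Y Phi.
have [CG CG0 GC] := linear_bounded X Y G.
have [M RM] := subgradients_locally_bounded X R x0 cR.
pose L := CG * (`|M| + 1).
have L0 : 0 < L by rewrite mulr_gt0// ltr_wpDl.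
pose q k := G (adjoint Phi (p k)).
have qR k : subgradients X R (x0 + t k *: u k) (adjoint Phi (q k)).
  by rewrite /q GE.
(* with this c the certificate accounts for at most half of the noise *)
pose c := (2 * L)^-1.
have c0 : 0 < c by rewrite invr_gt0 mulr_gt0.
have [kappa [dbar [kappa0 dbar0 rec]]] := stab c c0.
(* the summand 1 / (k + 1) keeps the noise level positive when Phi (u k)
   vanishes *)
pose s k := `|Phi (u k)| + k.+1%:R^-1.
have s0 k : 0 < s k by rewrite ltr_wpDl.
have scvg : s k @[k --> \oo] --> (0 : K).
  have -> : 0 = `|Phi w| + 0 :> K by rewrite Phiw normr0 addr0.
  apply: cvgD; last exact: cvg_harmonic.
  by apply: cvg_norm; apply: (continuous_cvg _ (linear_continuous X Y Phi _)).
pose delta k := 2 * (t k * s k).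
have delta0 k : 0 < delta k by rewrite !mulr_gt0.
have dcvg : delta k @[k --> \oo] --> (0 : K).
  rewrite -[X in _ --> X](mulr0 2); apply: cvgM; first exact: cvg_cst.
  by rewrite -[X in _ --> X](mulr0 0); exact: cvgM.
have tucvg : t k *: u k @[k --> \oo] --> (0 : X).
  by rewrite -[X in _ --> X](scale0r w); exact: cvgZ.
apply/eqP; rewrite -normr_eq0 eq_le normr_ge0 andbT.
apply: (@ler_cvg_to _ (\oo : set_system nat) _ K
  (fun k => `|u k|) (fun k => 2 * kappa * s k)).
- exact: cvg_norm.
- by rewrite -[X in _ --> X](mulr0 (2 * kappa)); apply: cvgM => //; exact: cvg_cst.
near=> k.
have qL : `|q k| <= L.
  apply: le_trans (GC _) _; rewrite ler_wpM2l// ?ltW//.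
  have tu1 : `|x0 + t k *: u k - x0| <= 1.
    rewrite [x0 + _]addrC addrK; near: k.
    by apply: (cvgr0_norm_le _ tucvg); exact: ltr01.
  by have := RM _ _ tu1 (pR k); have := ler_norm M; lra.
have dk : 0 < delta k < dbar.
  rewrite delta0/=; near: k; exact: (cvgr_lt _ dcvg).
pose y := Phi (x0 + t k *: u k) + (c * delta k) *: q k.
have cd0 : 0 < c * delta k by rewrite mulr_gt0.
have cLE : c * L = 2^-1 by rewrite /c; field; rewrite gt_eqF.
have yd : `|y - Phi x0| <= delta k.
  rewrite /y linearD/= linearZ/= addrAC [Phi x0 + _]addrC addrK.
  apply: le_trans (ler_normD _ _) _.
  rewrite (normrZ (t k)) (normrZ (c * delta k)) (gtr0_norm (t0 k)) (gtr0_norm cd0).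
  have := ler_wpM2l (ltW cd0) qL.
  rewrite [_ * L]mulrAC cLE /delta /s mulrDr.
  have : 0 < t k * k.+1%:R^-1 by rewrite mulr_gt0.
  by move: (k.+1%:R^-1) => N; lra.
have ymin : argmin [set: X] (regularized_objective Phi R y (c * delta k))
    (x0 + t k *: u k).
  apply/(regularized_argminP X Y Phi R y _ _ cvxR cd0).
  by rewrite /y [Phi _ + _]addrC addrK scalerA mulVf ?gt_eqF// scale1r.
have := rec _ dk y yd _ ymin; rewrite [x0 + _]addrC addrK normrZ gtr0_norm//.
have -> : kappa * delta k = t k * (2 * kappa * s k) by rewrite /delta; ring.
by rewrite ler_pM2l.
Unshelve. all: by end_near. Qed.

Context (x0min : forall z, Phi z = Phi x0 -> R x0 <= R z).

Lemma tangent_cone_certified0 : tangent_cone Omega x0 0.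
Proof.
exists (fun k => k.+1%:R^-1), (fun=> 0); split=> [k|||k].
- by rewrite invr_gt0.
- exact: cvg_harmonic.
- exact: cvg_cst.
rewrite scaler0 addr0; apply/certified_pointsE.
exact: lagrange_multiplier.
Qed.

(** Comparing the objective at [x] and [x0], with
    [R x >= R x0 + <p, Phi (x - x0)>] for a multiplier [p], gives a quadratic
    inequality in [a = |Phi x - y|] that is homogeneous in [a] and [delta],
    hence [a = O(delta)]. *)
Lemma residual_bound c : 0 < c ->
  exists2 C, 0 < C & forall delta y x, 0 < delta -> `|y - Phi x0| <= delta ->
    argmin [set: X] (regularized_objective Phi R y (c * delta)) x ->
    `|Phi (x - x0)| <= C * delta /\ R x <= R x0 + C * delta.
Proof.
move=> c0; have [p pR] := lagrange_multiplier X Y Phi R x0 cR cvxR x0min.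
have P0 : 0 <= `|p| := normr_ge0 p.
have cP0 : 0 <= c * `|p| := mulr_ge0 (ltW c0) P0.
have ic0 : 0 < c^-1 by rewrite invr_gt0.
exists (2 + 2 * (c * `|p|) + c^-1); first by lra.
move=> delta y x d0 yd [_ /(_ x0 I)]; rewrite /regularized_objective.
rewrite distrC in yd.
set a := `|Phi x - y|; set b := `|Phi x0 - y| => opt.
have a0 : 0 <= a := normr_ge0 _.
have b0 : 0 <= b := normr_ge0 _.
have b2 : b ^+ 2 <= delta ^+ 2 by rewrite ler_sqr ?nnegrE ?(ltW d0).
have PhiB : `|Phi (x - x0)| <= a + delta.
  rewrite linearB/= -(subrK y (Phi x)) -addrA.
  by apply: le_trans (ler_normD _ _) _; rewrite lerD2l distrC.
have pb : - (`|p| * (a + delta)) <= dot p (Phi (x - x0)).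
  have := cauchy_schwarz Y p (Phi (x - x0)); rewrite ler_norml => /andP[+ _].
  by apply: le_trans; rewrite lerN2 ler_wpM2l.
have := pR x; rewrite (dotC (adjoint _ _)) -adjointP dotC => Rx.
have cd0 : 0 < c * delta by rewrite mulr_gt0.
have key : a ^+ 2 <= delta ^+ 2 + 2 * (c * `|p|) * delta * (a + delta).
  have := ler_wpM2l (ltW cd0) Rx; have := ler_wpM2l (ltW cd0) pb.
  by lra.
have aC : a <= (1 + 2 * (c * `|p|)) * delta.
  rewrite leNgt; apply/negP => aC.
  have : (1 + 2 * (c * `|p|)) * delta * delta
      < a * (a - 2 * (c * `|p|) * delta).
    have ad : delta < a - 2 * (c * `|p|) * delta by lra.
    have sd0 : 0 < (1 + 2 * (c * `|p|)) * delta by rewrite mulr_gt0//; lra.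
    by apply: ltr_pM => //; exact: ltW.
  by lra.
split; first by have := mulr_ge0 (ltW ic0) (ltW d0); lra.
have : c * delta * (R x - R x0) <= delta ^+ 2.
  by have := sqr_ge0 a; have := sqr_ge0 delta; lra.
rewrite expr2 mulrAC -ler_pdivlMr// mulfK ?gt_eqF// mulrC -ler_pdivlMr//.
by have := mulr_ge0 cP0 (ltW d0); lra.
Qed.

Context (kerT0 : forall w,
  w \in lker Phi -> tangent_cone Omega x0 w -> w = 0).

(** The segment from [x0] to another minimizer [z] consists of minimizers, all
    certified by the multiplier at [x0]; so [z - x0] is tangent and lies in
    the kernel. *)
Lemma unique_minimizer z : Phi z = Phi x0 -> R z <= R x0 -> z = x0.
Proof.
move=> Phiz Rz; have [p pR] := lagrange_multiplier X Y Phi R x0 cR cvxR x0min.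
have Phiw : Phi (z - x0) = 0 by rewrite linearB/= Phiz subrr.
apply/eqP; rewrite -subr_eq0; apply/eqP/kerT0; first by rewrite memv_ker Phiw.
exists (fun k => k.+1%:R^-1), (fun=> z - x0); split=> [k|||k].
- by rewrite invr_gt0.
- exact: cvg_harmonic.
- exact: cvg_cst.
apply/certified_pointsE; exists p => z'.
have dw : dot (adjoint Phi p) (z - x0) = 0.
  by rewrite dotC -adjointP Phiw dot0l.
have k0 : 0 <= k.+1%:R^-1 :> K by rewrite invr_ge0.
have k1 : k.+1%:R^-1 <= 1 :> K by rewrite invf_le1// ler1n.
have := convex_function_ray X R x0 (z - x0) k.+1%:R^-1 cvxR.
rewrite k0 k1 subrKC => /(_ isT).
have : k.+1%:R^-1 * (R z - R x0) <= 0 by rewrite mulr_ge0_le0// subr_le0.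
have := pR z'; rewrite opprD addrA (dotBr X (z' - x0)) dotZr dw mulr0 subr0.
by move: (k.+1%:R^-1) => N; lra.
Qed.

(** If [|x - x0| >= eps], the point of the segment from [x0] to [x] at distance
    [eps] from [x0] satisfies the same two bounds, by convexity, and
    [penalization] on the sphere excludes it for small [eta]. *)
Lemma near_minimizers_localized eps : 0 < eps ->
  exists2 eta, 0 < eta & forall x,
    `|Phi (x - x0)| <= eta -> R x <= R x0 + eta -> `|x - x0| < eps.
Proof.
move=> eps0.
have Rsphere x : `|x - x0| = eps -> Phi x = Phi x0 -> R x0 < R x.
  move=> xeps Phix; rewrite ltNge; apply/negP => /(unique_minimizer _ Phix) xx0.
  by move: eps0; rewrite -xeps xx0 subrr normr0 ltxx.
have [n [eta [eta0 Reta]]] :=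
  penalization X Y Phi R _ x0 (R x0) cR (compact_sphere X x0 eps) Rsphere.
have n1 : 0 < n%:R + 1 :> K by rewrite ltr_wpDl.
pose e := Num.min 1 (eta / (2 * (n%:R + 1))).
have e0 : 0 < e by rewrite lt_min ltr01 divr_gt0// mulr_gt0.
have e1 : e <= 1 by rewrite ge_min lexx.
have een : e * (2 * (n%:R + 1)) <= eta.
  by rewrite -ler_pdivlMr ?mulr_gt0// ge_min lexx orbT.
exists e => // x Phix Rx; rewrite ltNge; apply/negP => xeps.
have nx : 0 < `|x - x0| by exact: lt_le_trans xeps.
pose s := eps / `|x - x0|.
have s0 : 0 <= s by rewrite divr_ge0 ?ltW.
have s1 : s <= 1 by rewrite ler_pdivrMr// mul1r.
have := Reta (x0 + s *: (x - x0)); rewrite /= [x0 + _ - _]addrC addKr.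
rewrite linearZ/= (normrZ s (x - x0)) (normrZ s (Phi _)) (ger0_norm s0).
have sx : s * `|x - x0| = eps by rewrite divfK ?gt_eqF.
move=> /(_ sx).
have := convex_function_ray X R x0 (x - x0) s cvxR; rewrite s0 s1 subrKC.
move=> /(_ isT) Rs.
have sR : s * (R x - R x0) <= e.
  apply: (@le_trans _ _ (s * e)); last by rewrite ler_piMl// ltW.
  by rewrite ler_wpM2l//; lra.
have sPhi : (s * `|Phi (x - x0)|) ^+ 2 <= e.
  have sPe : s * `|Phi (x - x0)| <= e.
    apply: (@le_trans _ _ (s * e)); last by rewrite ler_piMl// ltW.
    by rewrite ler_wpM2l.
  have sP0 : 0 <= s * `|Phi (x - x0)| := mulr_ge0 s0 (normr_ge0 _).
  rewrite expr2; apply: (@le_trans _ _ (1 * e)); last by rewrite mul1r.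
  by apply: ler_pM => //; exact: le_trans e1.
have := ler_wpM2l (ler0n K n) sPhi.
by lra.
Qed.

Lemma tangent_stable_recovery : stably_recoverable Phi R (Phi x0) x0.
Proof.
move=> c c0; have [C C0 res] := residual_bound c c0.
apply: contrapT => notstab.
have /choice[delta] (k : nat) : exists delta : K, exists x : X,
    [/\ 0 < delta, delta < k.+1%:R^-1,
        exists p, subgradients X R x (adjoint Phi p),
        `|Phi (x - x0)| <= C * delta /\ R x <= R x0 + C * delta
      & k.+1%:R * delta < `|x - x0|].
  apply: contrapT => nx; apply: notstab.
  exists k.+1%:R, k.+1%:R^-1; split; rewrite ?invr_gt0//.
  move=> delta /andP[d0 dk] y yd x xmin; rewrite leNgt; apply/negP => xd.
  apply: nx; exists delta, x; split=> //; last exact: (res _ y).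
  have cd0 : 0 < c * delta by rewrite mulr_gt0.
  have := (regularized_argminP X Y Phi R y _ x cvxR cd0).1 xmin.
  by exists ((c * delta)^-1 *: (y - Phi x)).
move=> /choice[x] /all_and5[d0 dk xR xres xd].
have t0 k : 0 < `|x k - x0| by apply: le_lt_trans (xd k); rewrite mulr_ge0 ?ltW.
pose u k := `|x k - x0|^-1 *: (x k - x0).
have uS k : [set w | `|w - 0| = 1] (u k).
  by rewrite /= subr0 normrZ gtr0_norm ?invr_gt0// mulVf// gt_eqF.
have xt k : x k = x0 + `|x k - x0| *: u k.
  by rewrite scalerA mulfV ?gt_eqF// scale1r subrKC.
have [phi [w [w1 phioo ucvg]]] :=
  compact_subsequence X _ u (compact_sphere X 0 1) uS.
have dcvg : delta k @[k --> \oo] --> (0 : K).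
  apply: (@squeeze_cvgr _ _ _ _ (fun=> 0) (fun k => k.+1%:R^-1)).
  - by apply: nearW => k; rewrite (ltW (d0 k)) (ltW (dk k)).
  - exact: cvg_cst.
  - exact: cvg_harmonic.
have tcvg : `|x k - x0| @[k --> \oo] --> (0 : K).
  apply/cvgr0Pnorm_lt => e e0; have [eta eta0 loc] := near_minimizers_localized _ e0.
  near=> k; rewrite normr_id.
  have Cd : C * delta k <= eta.
    rewrite mulrC -ler_pdivlMr//; near: k.
    by apply: (cvgr_le _ dcvg); rewrite divr_gt0.
  have [Phik Rk] := xres k; apply: loc; first exact: le_trans Cd.
  by apply: le_trans Rk _; rewrite lerD2l.
have Phiu k : `|Phi (u k)| <= C * k.+1%:R^-1.
  rewrite linearZ/= normrZ gtr0_norm ?invr_gt0// mulrC ler_pdivrMr//.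
  apply: le_trans (xres k).1 _; rewrite -mulrA ler_wpM2l ?ltW//.
  by rewrite ltr_pdivlMl.
have Phiw : Phi w = 0.
  apply/eqP; rewrite -normr_eq0 eq_le normr_ge0 andbT.
  apply: (@ler_cvg_to _ (\oo : set_system nat) _ K
    (fun k => `|Phi (u (phi k))|) (fun k => C * (phi k).+1%:R^-1)).
  - by apply: cvg_norm; apply: (continuous_cvg _ (linear_continuous X Y Phi _)).
  - rewrite -[X in _ --> X](mulr0 C); apply: cvgM; first exact: cvg_cst.
    exact: cvg_comp phioo (@cvg_harmonic K).
  - by apply: nearW => k; exact: Phiu.
have w0 : w = 0.
  apply: kerT0; first by rewrite memv_ker Phiw.
  exists (fun k => `|x (phi k) - x0|), (u \o phi); split=> // [|k].
    exact: cvg_comp phioo tcvg.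
  by apply/certified_pointsE; rewrite /= -xt; exact: xR.
by move: w1; rewrite /= w0 subr0 normr0 => /eqP; rewrite eq_sym oner_eq0.
Unshelve. all: by end_near. Qed.

End StableRecovery.

Theorem theorem3p3 (K : realType) (X Y : euclideanType K) (Phi : 'Hom(X, Y))
    (R : X -> K) (y0 : Y) (x0 : X) :
  continuous R ->
  convex_function [set: convex_lmodType X] R ->
  argmin [set x | Phi x = y0] R x0 ->
  stably_recoverable Phi R y0 x0 <->
  [set` lker Phi] `&`
    tangent_cone
      (\bigcup_(v in range (adjoint Phi)) subdifferential (fenchel_conjugate R) v)
      x0
  = [set 0].
Proof.
move=> cR cvxR [<- x0min].
split=> [stab|kerT].
  apply/seteqP; split=> [w [] /= kerw Tw|_ ->].
    exact: (stable_recovery_tangent _ _ _ cR cvxR w stab kerw Tw).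
  split; first by rewrite /= mem0v.
  exact: tangent_cone_certified0.
apply: tangent_stable_recovery => // w kerw Tw.
by have : [set 0] w by rewrite -kerT.
Qed.
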